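(* For every integer $n\ge 6$, the path $\mathcal{P}_n$ on $n$ vertices has at least $(\lceil\sqrt{n-1}\,\rceil-1)!$ pairwise nonequivalent optimal cointersection representations.
   Context: Graphs are finite, simple and undirected. For a graph $\mathcal{G}=(\mathcal{V},\mathcal{E})$ and positive integers $\alpha,\beta$, an $(\alpha\mid\beta)$-cointersection representation (CIR) of $\mathcal{G}$ consists of two disjoint finite sets of features $\mathcal{A},\mathcal{B}$ with $|\mathcal{A}|=\alpha$, $|\mathcal{B}|=\beta$, together with an assignment to each vertex $v$ of subsets $A_v\subseteq\mathcal{A}$, $B_v\subseteq\mathcal{B}$ (possibly empty), such that for all distinct $u,v\in\mathcal{V}$: $(u,v)\in\mathcal{E}$ if and only if $A_u\cap A_v\neq\varnothing$ and $B_u\cap B_v\neq\varnothing$. The cointersection number $\theta^{c}(\mathcal{G})$ is the minimum of $\alpha+\beta$ over all CIRs of $\mathcal{G}$; a CIR is optimal if $\alpha+\beta=\theta^{c}(\mathcal{G})$. Two CIRs $(\mathcal{A},\mathcal{B},(A_v,B_v)_v)$ and $(\mathcal{A}',\mathcal{B}',(A'_v,B'_v)_v)$ of the same graph are equivalent if either there are bijections $\varphi:\mathcal{A}\to\mathcal{A}'$, $\psi:\mathcal{B}\to\mathcal{B}'$ with $A'_v=\varphi(A_v)$ and $B'_v=\psi(B_v)$ for all $v$, or there are bijections $\varphi:\mathcal{A}\to\mathcal{B}'$, $\psi:\mathcal{B}\to\mathcal{A}'$ with $B'_v=\varphi(A_v)$ and $A'_v=\psi(B_v)$ for all $v$ (i.e.,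 one is obtained from the other by permuting features within each set and possibly swapping the roles of the two feature sets). *)

(* Defs.v *)
From HB Require Import structures.
From mathcomp Require Import all_boot all_order all_algebra.
From mathcomp Require Import boolp reals.

Set Implicit Arguments.
Unset Strict Implicit.
Unset Printing Implicit Defensive.

Import GRing.Theory Num.Theory.

Record sgraph := SGraph {
  vertex :> finType;
  edge : rel vertex;
  edge_sym : symmetric edge;
  edge_irr : irreflexive edge }.

Section Path.
Variable n : nat.

Definition path_edge : rel 'I_n := fun i j => (i.+1 == j) || (j.+1 == i).

Lemma path_edge_sym : symmetric path_edge.
Proof. by move=> i j; rewrite /path_edge orbC. Qed.

Lemma path_edge_irr : irreflexive path_edge.
Proof. by move=> i; rewrite /path_edge orbb; apply/negbTE; rewrite eqn_leq ltnn. Qed.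

Definition path_graph : sgraph := SGraph path_edge_sym path_edge_irr.

End Path.

(* A cointersection representation.  The two feature sets are two separate    *)
(* types, which is how their disjointness is rendered: no feature of one kind *)
(* can be a feature of the other kind.                                        *)
Record cir (G : sgraph) := Cir {
  featA : finType;
  featB : finType;
  repA : G -> {set featA};
  repB : G -> {set featB};
  featA_gt0 : 0 < #|featA|;
  featB_gt0 : 0 < #|featB|;
  cirP : forall u v : G, u != v ->
    edge u v = (repA u :&: repA v != set0) && (repB u :&: repB v != set0) }.

Definition cir_size (G : sgraph) (c : cir G) : nat := #|featA c| + #|featB c|.

(* Every graph has a representation: one A-feature per oriented edge (plus a  *)
(* dummy one) and a single B-feature carried by all vertices.                 *)
Lemma cir_exists (G : sgraph) : exists k, `[< exists c : cir G, cir_size c = k >].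
Proof.
pose A (v : G) : {set option (G * G)} :=
  [set x | if x is Some (u, w) then edge u w && ((v == u) || (v == w)) else false].
pose B (v : G) : {set unit} := setT.
have A0 : 0 < #|{: option (G * G)}| by apply/card_gt0P; exists None.
have B0 : 0 < #|{: unit}| by rewrite card_unit.
have H (u v : G) : u != v ->
    edge u v = (A u :&: A v != set0) && (B u :&: B v != set0).
  move=> uv; have -> : B u :&: B v != set0 by apply/set0Pn; exists tt; rewrite !inE.
  rewrite andbT; apply/idP/set0Pn => [e|[[[x y]|]]].
  - by exists (Some (u, v)); rewrite !inE e !eqxx orbT.
  - rewrite !inE => /andP[/andP[e ux] /andP[_ vx]].
    by case/orP: ux vx uv => /eqP-> /orP[] /eqP->; rewrite ?eqxx // edge_sym.
  - by rewrite !inE.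
by exists (cir_size (Cir A0 B0 H)); apply/asboolP; exists (Cir A0 B0 H).
Qed.

Definition cointersection_number (G : sgraph) : nat := ex_minn (cir_exists G).

Definition optimal_cir (G : sgraph) (c : cir G) : Prop :=
  cir_size c = cointersection_number G.

Definition cir_equiv (G : sgraph) (c c' : cir G) : Prop :=
  (exists (phi : featA c -> featA c') (psi : featB c -> featB c'),
    [/\ bijective phi, bijective psi &
        forall v, repA c' v = phi @: repA c v /\ repB c' v = psi @: repB c v]) \/
  (exists (phi : featA c -> featB c') (psi : featB c -> featA c'),
    [/\ bijective phi, bijective psi &
        forall v, repB c' v = phi @: repA c v /\ repA c' v = psi @: repB c v]).

(* The integer ceiling is nonnegative here, so the absolute value only casts  *)
(* it to nat.                                                                 *)
Definition ceil_sqrt (R : realType) (x : R) : nat := absz (Num.ceil (Num.sqrt x)).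

(* Main.v *)
(**
Choosing, for every edge of a path with [m] edges, a common A-feature and a
common B-feature of its endpoints sends the edges injectively to cells of the
|A| x |B| grid: two edges on the same cell would span a clique.  Hence
|A| |B| >= m.  Conversely, a walk of [m] pairwise distinct cells in which
consecutive cells share a row or a column yields a representation.  With
k = ceil (sqrt m), the minimal |A| + |B| is reached by a grid with k columns
and k or k - 1 rows, filled row by row.  The first row is read from left to
right, and the other ones in the order given by a permutation of the columns
fixing the last one, alternately backwards and forwards.  The first row labels
the columns canonically, so that the second row, even if its last cell is
missing, recovers the permutation: this gives (k - 1)! classes.
*)
Require Import Defs.
From mathcomp Require Import all_boot all_order all_algebra all_fingroup.
From mathcomp Require Import boolp reals.
From mathcomp Require Import zify.

Set Implicit Arguments.
Unset Strict Implicit.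
Unset Printing Implicit Defensive.

Import Order.TTheory GRing.Theory Num.Theory.

Lemma ceil_sqrt_nat (R : realType) (m : nat) : 0 < m ->
  exists2 k, ceil_sqrt (m%:R : R)%R = k.+1 & k ^ 2 < m <= k.+1 ^ 2.
Proof.
move=> m_gt0; rewrite /ceil_sqrt.
have s_gt0 : (0 < Num.sqrt (m%:R : R))%R by rewrite sqrtr_gt0 ltr0n.
have sqr_s : (Num.sqrt (m%:R : R) ^+ 2 = m%:R)%R by rewrite sqr_sqrtr ?ler0n.
move: (s_gt0); rewrite -ceil_gt0.
have /andP[] := ceil_itv (Num.sqrt (m%:R : R))%R.
case: (Num.ceil _) => [[|k]|k] //= lb ub _.
exists k => //.
have {}lb : ((k%:R : R) < Num.sqrt m%:R)%R.
  by move: lb; rewrite intS addrAC subrr add0r -pmulrn.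
apply/andP; split.
  by rewrite -(ltr_nat R) natrX -sqr_s ltr_pXn2r // nnegrE ?ler0n // ltW.
by rewrite -(ler_nat R) natrX -sqr_s ler_pXn2r // nnegrE ?ler0n // ltW.
Qed.

(** * Lower bound on the size of a representation *)

Lemma path_cir_leq_mul m (c : cir (path_graph m.+1)) :
  m <= #|featA c| * #|featB c|.
Proof.
pose lo (t : 'I_m) : path_graph m.+1 := widen_ord (leqnSn m) t.
pose hi (t : 'I_m) : path_graph m.+1 := lift ord0 t.
have lohi t : exists p : featA c * featB c,
    [&& p.1 \in repA c (lo t), p.1 \in repA c (hi t),
        p.2 \in repB c (lo t) & p.2 \in repB c (hi t)].
  have ne : lo t != hi t by rewrite -val_eqE /= neq_ltn leqnn.
  have : edge (lo t) (hi t) by rewrite /= /path_edge eqxx.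
  rewrite (cirP c ne) => /andP[/set0Pn[a] + /set0Pn[b]].
  by rewrite !inE => /andP[? ?] /andP[? ?]; exists (a, b); apply/and4P.
have [f fP] := boolp.choice lohi.
(* [lo t] and [hi u] are at distance at least 2, so they are not adjacent; a cell shared by the
   edges [t] and [u] would make them so. *)
have apart (t u : 'I_m) : t < u -> f t != f u.
  move=> lt_tu; apply/eqP => ftu.
  have ne : lo t != hi u by rewrite -val_eqE /= /bump; lia.
  have : edge (lo t) (hi u) = false by rewrite /= /path_edge /= /bump; lia.
  have /and4P[At _ Bt _] := fP t; have /and4P[_ Au _ Bu] := fP u.
  rewrite (cirP c ne) => /negP; apply; apply/andP; split; apply/set0Pn.
    by exists (f t).1; rewrite inE At ftu.
  by exists (f t).2; rewrite inE Bt ftu.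
have f_inj : injective f.
  move=> t u ftu; apply: val_inj; case: (ltngtP t u) => // /apart.
    by rewrite ftu eqxx.
  by rewrite ftu eqxx.
by rewrite -card_prod -[m in m <= _]card_ord; apply: leq_card f_inj.
Qed.

Lemma optimal_cir_min (G : sgraph) (c : cir G) :
  (forall c' : cir G, cir_size c <= cir_size c') -> optimal_cir c.
Proof.
move=> c_min; rewrite /optimal_cir /cointersection_number.
case: ex_minnP => N /asboolP[c' <-] Nmin; apply/eqP; rewrite eqn_leq c_min.
by apply: Nmin; apply/asboolP; exists c.
Qed.

(** * Representations from walks on a grid *)

(* Edge [t] of the path joins the vertices [t] and [t.+1]. *)
Definition incident (t v : nat) : bool := (t == v) || (t.+1 == v).

Definition walk_feat m (F : finType) (f : nat -> F) (v : path_graph m.+1) :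
  {set F} := [set f t | t : 'I_m & incident t v].

Lemma walk_featP m (F : finType) (f : nat -> F) (v : path_graph m.+1) x :
  reflect (exists t, [/\ t < m, incident t v & x = f t]) (x \in walk_feat f v).
Proof.
apply: (iffP imsetP) => [[t + ->]|[t [lt_tm tv ->]]].
  by rewrite inE => tv; exists t; rewrite ltn_ord.
by exists (Ordinal lt_tm); rewrite ?inE.
Qed.

Section RookWalk.
Variables (m : nat) (A B : finType) (row : nat -> A) (col : nat -> B).

Hypothesis cell_inj : forall t u, t < m -> u < m ->
  row t = row u -> col t = col u -> t = u.
Hypothesis rook : forall t, t.+1 < m -> row t = row t.+1 \/ col t = col t.+1.

(** At most two cells, consecutive ones, meet at a vertex. By [rook] they agree in a row or a
    column, so mixing the row of one with the column of the other gives one of the two again. *)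
Lemma walk_cell (v : path_graph m.+1) a b :
  a \in walk_feat row v -> b \in walk_feat col v ->
  exists t, [/\ t < m, incident t v, row t = a & col t = b].
Proof.
move=> /walk_featP[t [tm tv ->]] /walk_featP[u [um uv ->]].
have /or3P[/eqP tu|/eqP ut|/eqP tu] : [|| t == u, u == t.+1 | t == u.+1].
  by move: tv uv; rewrite /incident; lia.
- by exists t; split; rewrite // tu.
- have [|E|E] := @rook t; first by rewrite -ut.
    by exists u; split; rewrite // ut E.
  by exists t; split; rewrite // ut E.
- have [|E|E] := @rook u; first by rewrite -tu.
    by exists u; split; rewrite // tu E.
  by exists t; split; rewrite // tu E.
Qed.

Lemma walkP (u v : path_graph m.+1) : u != v ->
  edge u v = (walk_feat row u :&: walk_feat row v != set0)
          && (walk_feat col u :&: walk_feat col v != set0).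
Proof.
move=> uv; apply/idP/andP => [e|[/set0Pn[a +] /set0Pn[b]]].
  have [t [tm tu tv]] : exists t, [/\ t < m, incident t u & incident t v].
    move: e (ltn_ord u) (ltn_ord v); rewrite /= /path_edge /incident.
    case/orP => /eqP E u_lt v_lt.
      by exists u; rewrite E !eqxx orbT; split; first lia.
    by exists v; rewrite E !eqxx orbT; split; first lia.
  split; apply/set0Pn.
    by exists (row t); rewrite inE; apply/andP; split; apply/walk_featP; exists t.
  by exists (col t); rewrite inE; apply/andP; split; apply/walk_featP; exists t.
rewrite !inE => /andP[au av] /andP[bu bv].
(* Both cells are [(a, b)], so a single edge is incident to [u] and to [v]. *)
have [t [tm tu ta tb]] := walk_cell au bu.
have [s [sm sv sa sb]] := walk_cell av bv.
have ts : t = s by apply: cell_inj; rewrite ?ta ?tb.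
by move: uv tu sv; rewrite -val_eqE /= /path_edge /incident ts; lia.
Qed.

Hypothesis A_gt0 : 0 < #|A|.
Hypothesis B_gt0 : 0 < #|B|.

Definition walk_cir : cir (path_graph m.+1) := Cir A_gt0 B_gt0 walkP.

End RookWalk.

(* Vertex [t.+1] carries [f t] and [f t.+1], so that [f t] gives [f t.+1]. *)
Lemma walk_feat_imset m (F F' : finType) (f : nat -> F) (f' : nat -> F')
    (psi : F -> F') :
  (forall v : path_graph m.+1, walk_feat f' v = psi @: walk_feat f v) ->
  forall t, t < m -> f' t = psi (f t).
Proof.
move=> eq_walk; elim=> [|t IHt] lt_tm.
  have : f' 0 \in walk_feat f' (ord0 : path_graph m.+1).
    by apply/walk_featP; exists 0.
  rewrite eq_walk => /imsetP[_ /walk_featP[u [_ + ->]] ->].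
  by rewrite /incident orbF => /eqP ->.
have {IHt} IHt := IHt (ltnW lt_tm).
pose v : path_graph m.+1 := Ordinal (ltnW lt_tm : t.+1 < m.+1).
have incE u : incident u v -> u = t \/ u = t.+1.
  by rewrite /incident /= eqSS => /orP[] /eqP ->; [right|left].
have t1v : incident t.+1 v by rewrite /incident eqxx.
have /walk_featP[w [_ /incE w_eq t1w]] : psi (f t.+1) \in walk_feat f' v.
  by rewrite eq_walk imset_f //; apply/walk_featP; exists t.+1.
have : f' t.+1 \in walk_feat f' v by apply/walk_featP; exists t.+1.
rewrite eq_walk => /imsetP[_ /walk_featP[u [_ /incE u_eq ->]] t1u].
(* If [u] and [w] are both [t], then [f' t.+1 = psi (f t) = f' t = psi (f t.+1)]. *)
move: u_eq w_eq t1u t1w => [] -> // [] -> t1u t1w.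
  by rewrite t1u t1w IHt.
by rewrite t1w.
Qed.

(** * Snakes filling a grid row by row *)

Section Snake.
Variables (a k : nat) (s : 'S_k.+1).

Definition snake_row (t : nat) : 'I_a.+1 := inord (t %/ k.+1).

Definition snake_col (t : nat) : 'I_k.+1 :=
  let j := inord (t %% k.+1) in
  if t %/ k.+1 == 0 then j
  else s (if odd (t %/ k.+1) then rev_ord j else j).

Lemma snake_col_row0 t : t < k.+1 -> snake_col t = inord t.
Proof. by move=> lt_tk; rewrite /snake_col divn_small // modn_small. Qed.

Lemma snake_col_row1 (j : 'I_k.+1) : snake_col (k.+1 + rev_ord j) = s j.
Proof.
have lt_rev := ltn_ord (rev_ord j).
rewrite /snake_col divnDl // divnn divn_small // modnDl modn_small //=.
by rewrite (inord_val (rev_ord j)) rev_ordK.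
Qed.

Lemma snake_inj t u : t < a.+1 * k.+1 -> u < a.+1 * k.+1 ->
  snake_row t = snake_row u -> snake_col t = snake_col u -> t = u.
Proof.
rewrite -!ltn_divLR // => ta ua /(congr1 val); rewrite /= !inordK // => eq_row.
rewrite /snake_col eq_row => eq_col.
suff eq_mod : t %% k.+1 = u %% k.+1.
  by rewrite (divn_eq t k.+1) (divn_eq u k.+1) eq_row eq_mod.
rewrite -(@inordK k (t %% _)) ?ltn_pmod // -(@inordK k (u %% _)) ?ltn_pmod //.
congr (nat_of_ord _); case: eqP eq_col => // _ /perm_inj.
by case: odd => // /rev_ord_inj.
Qed.

Hypothesis s_max : s ord_max = ord_max.

Lemma snake_rook t :
  snake_row t = snake_row t.+1 \/ snake_col t = snake_col t.+1.
Proof.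
rewrite /snake_row /snake_col divnS // modnS.
case: (boolP (k.+1 %| t.+1)) => [dvd|_]; [right|by left].
have -> : t %% k.+1 = k.
  case/dvdnP: dvd => [[//|q]] t_eq.
  have -> : t = q * k.+1 + k by lia.
  by rewrite modnMDl modn_small.
have -> : inord k = ord_max :> 'I_k.+1 by apply: val_inj; rewrite /= inordK.
have -> : inord 0 = ord0 :> 'I_k.+1 by apply: val_inj; rewrite /= inordK.
have rev0 : rev_ord ord0 = ord_max :> 'I_k.+1.
  by apply: val_inj; rewrite /= subn1.
have revm : rev_ord ord_max = ord0 :> 'I_k.+1.
  by apply: val_inj; rewrite /= subnn.
(* Only at the turn into the second row does [s] act on one side alone: there [s_max] is needed. At
   later turns both sides apply [s] to the same column. *)
case: eqP => [->|_] /=; first by rewrite rev0 s_max.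
by case: odd; rewrite /= ?rev0 ?revm.
Qed.

Variable m : nat.
Hypothesis m_le : m <= a.+1 * k.+1.

Let snake_inj_le t u : t < m -> u < m ->
  snake_row t = snake_row u -> snake_col t = snake_col u -> t = u.
Proof. by move=> tm um; apply: snake_inj; apply: leq_trans m_le. Qed.

Let snake_rook_le t : t.+1 < m ->
  snake_row t = snake_row t.+1 \/ snake_col t = snake_col t.+1.
Proof. by move=> _; apply: snake_rook. Qed.

Let ord_gt0 b : 0 < #|'I_b.+1|. Proof. by rewrite card_ord. Qed.

Definition snake_cir : cir (path_graph m.+1) :=
  walk_cir snake_inj_le snake_rook_le (ord_gt0 a) (ord_gt0 k).

End Snake.

(** * Inequivalence and optimality of snakes *)

Lemma perm_eq_off (T : finType) (x : T) (s s' : {perm T}) :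
  (forall y, y != x -> s y = s' y) -> s = s'.
Proof.
move=> eq_s; apply/permP => y; have [->|/eq_s//] := eqVneq y x.
have [z sz] : exists z, s' z = s x by exists (s'^-1 (s x))%g; rewrite permKV.
have [zx|/eq_s] := eqVneq z x; first by rewrite -sz zx.
by rewrite sz => /perm_inj zx; rewrite -sz zx.
Qed.

Lemma snake_cir_equiv_inj a k m (s s' : 'S_k.+1) (s_max : s ord_max = ord_max)
    (s'_max : s' ord_max = ord_max) (m_le : m <= a.+1 * k.+1) :
  0 < k -> k.*2 < m ->
  cir_equiv (snake_cir s_max m_le) (snake_cir s'_max m_le) -> s = s'.
Proof.
move=> k_gt0 m_gt [] [phi [psi [_ _ eqv]]].
  have colE : forall t, t < m -> snake_col s' t = psi (snake_col s t).
    by apply: walk_feat_imset => v; have [] := eqv v.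
  have psi_id j : psi j = j.
    have lt_jm : j < m by have := ltn_ord j; lia.
    by have := colE j lt_jm; rewrite !snake_col_row0 ?inord_val.
  (* Column [s ord0] ends the second row, at index [k.*2.+1], which may be missing; the rest of that
     row has indices at most [k.*2 < m]. *)
  apply: (@perm_eq_off _ ord0) => j j_neq0.
  rewrite -(snake_col_row1 s) -(snake_col_row1 s') colE ?psi_id //=.
  by move: j_neq0; rewrite -val_eqE /=; have := ltn_ord j; lia.
(* The second vertex lies in one row and two columns: no swap is possible. *)
have v_lt : 1 < m.+1 by lia.
pose v : path_graph m.+1 := Ordinal v_lt.
have t0_lt : 0 < m by lia.
have t1_lt : 1 < m by lia.
have [eqB _] := eqv v.
have colsE t : t < m -> incident t v -> snake_col s' t = phi ord0.
  move=> tm tv.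
  have : snake_col s' t \in repB (snake_cir s'_max m_le) v.
    by apply/walk_featP; exists t.
  rewrite eqB => /imsetP[_ /walk_featP[u [_ uv ->]] ->]; congr phi.
  apply: val_inj; rewrite /snake_row divn_small /= ?inordK //.
  by move: uv; rewrite /incident /=; lia.
have := colsE 0 t0_lt isT; rewrite -(colsE 1 t1_lt isT).
by rewrite !snake_col_row0 // => /(congr1 val); rewrite /= !inordK.
Qed.

(** The snake has size [a + k + 2], and by AM-GM any representation of size S satisfies 4m <=
    4|A||B| <= S^2, whence S > a + k + 1. *)
Lemma snake_cir_optimal a k m (s : 'S_k.+1) (s_max : s ord_max = ord_max)
    (m_le : m <= a.+1 * k.+1) :
  (a + k + 1) ^ 2 < 4 * m -> optimal_cir (snake_cir s_max m_le).
Proof.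
move=> m_gt; apply: optimal_cir_min => c.
have /(leq_trans m_gt) : 4 * m <= 4 * (#|featA c| * #|featB c|).
  by rewrite leq_mul2l path_cir_leq_mul.
have := nat_AGM2 #|featA c| #|featB c|; case=> AGM _ /leq_trans/(_ AGM).
by rewrite ltn_sqr /cir_size /= !card_ord; lia.
Qed.

Theorem theorem7 (R : realType) (n : nat) (hn : 6 <= n) :
  exists r : 'I_((ceil_sqrt (n%:R - 1 : R)%R - 1)`!) -> cir (path_graph n),
    (forall i, optimal_cir (r i)) /\
    (forall i j, i != j -> ~ cir_equiv (r i) (r j)).
Proof.
case: n hn => [//|m] hm; rewrite -natr1 addrK.
have [|k -> /andP[k_lt k_ge]] := @ceil_sqrt_nat R m; first by lia.
rewrite subn1 /= -card_Sn.
(* Here [hm] enters: 5 <= m <= (k + 1)^2 forces k >= 2, and then 2k <= k^2 < m. *)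
have k_gt1 : 1 < k by case: k k_lt k_ge => [|[|k]] //; lia.
have m_gt : k.*2 < m by nia.
have [a m_le m_min] :
    exists2 a, m <= a.+1 * k.+1 & (a + k + 1) ^ 2 < 4 * m.
  (* Use k rows if they suffice, as (2k)^2 < 4m; otherwise k + 1 rows, and m > k(k + 1) gives (2k +
     1)^2 < 4m. *)
  have [m_small|m_big] := leqP m (k * k.+1).
    by exists k.-1; rewrite ?(prednK (ltnW k_gt1)) //; nia.
  by exists k; nia.
have fix_max (s : 'S_k) : lift_perm ord_max ord_max s ord_max = ord_max.
  exact: lift_perm_id.
exists (fun i => snake_cir (fix_max (enum_val i)) m_le); split=> [i|i j].
  exact: snake_cir_optimal.
move=> /eqP ne /(snake_cir_equiv_inj (ltnW k_gt1) m_gt) eq_lift; apply: ne.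
apply: enum_val_inj; apply/permP => x; apply: (@lift_inj _ ord_max).
by rewrite -!(lift_perm_lift ord_max ord_max) eq_lift.
Qed.
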